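(* Let $I\subseteq\mathbb{R}$ be an interval, let $f:I\to\mathbb{R}$ be differentiable on $I^\circ$, let $a,b\in I$ with $a<b$, let $0\le\lambda\le\frac12\le\mu\le1$, and suppose $f'\in L[a,b]$. If $|f'(x)|$ is convex on $[a,b]$, then $$\left|(1-\mu)f(a)+\lambda f(b)+(\mu-\lambda)f\left(\frac{a+b}2\right)-\frac1{b-a}\int_a^bf(x)\,dx\right|$$ $$\le\frac{b-a}{24}\Big[\big(10-3\lambda+8\lambda^3-15\mu+8\mu^3\big)|f'(a)|+\big(8-9\lambda+24\lambda^2-8\lambda^3-21\mu+24\mu^2-8\mu^3\big)|f'(b)|\Big].$$
   Context: $I^\circ$ denotes the interior of $I$, and $L[a,b]$ denotes the Lebesgue integrable functions on $[a,b]$. The hypotheses on $f'$ over $[a,b]$ presuppose that $f'$ exists at every point of $[a,b]$ (as a one-sided derivative at $a$ or $b$ if that point is an endpoint of $I$). *)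

(* Defs.v *)
From HB Require Import structures.
From mathcomp Require Import all_boot all_order all_algebra.
From mathcomp Require Import all_classical all_reals all_analysis.

Set Implicit Arguments.
Unset Strict Implicit.
Unset Printing Implicit Defensive.

Import Order.TTheory GRing.Theory Num.Theory.
Import numFieldNormedType.Exports.

Local Open Scope classical_set_scope.
Local Open Scope ring_scope.

(* A function f : I -> R is represented by a total function R -> R whose values
   outside I are irrelevant.  Its derivative at x is the limit of the difference
   quotient at x along I \ {x}: the usual derivative at interior points of I,
   the one-sided derivative at an endpoint belonging to I. *)
Definition derivable_on (R : realType) (I : set R) (f : R -> R) (x : R) : Prop :=
  cvg ((fun y => (f y - f x) / (y - x)) @ within I x^').

Definition derive_on (R : realType) (I : set R) (f : R -> R) (x : R) : R :=
  lim ((fun y => (f y - f x) / (y - x)) @ within I x^').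

(* Main.v *)
Require Import Defs.
From HB Require Import structures.
From mathcomp Require Import all_boot all_order all_algebra.
From mathcomp Require Import all_classical all_reals all_analysis.
From mathcomp Require Import ring lra.

Set Implicit Arguments.
Unset Strict Implicit.
Unset Printing Implicit Defensive.

Import Order.TTheory GRing.Theory Num.Theory.
Import numFieldNormedType.Exports.

Local Open Scope classical_set_scope.
Local Open Scope ring_scope.

(** The left-hand side is an integration error.  Put [p = b - mu * (b - a)],
    [m = (a + b) / 2] and [q = b - lam * (b - a)], so that
    [a <= p <= m <= q <= b].  Then
    [(1 - mu) * f a + (mu - lam) * f m + lam * f b] is the mean over [[a, b]] of
    the step function equal to [f a] on [[a, p]], [f m] on [[p, q]] and [f b]
    on [[q, b]], and each of the four intervals [[a, p]], [[p, m]], [[m, q]],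
    [[q, b]] has at one of its ends the node at which [f] is frozen.

    By convexity [`|f'|] lies below its chord on [[a, b]].  The chord is the
    second derivative of an explicit cubic [Q], so comparing derivatives gives
    [`|f y - f x| <= Q' y - Q' x] for [x <= y] ([ler_dist_derive1_horner]).  On
    each of the four intervals the error made by freezing [f] at an endpoint is
    therefore at most the error made by freezing [Q'] there
    ([ler_dist_Rintegral_left], [ler_dist_Rintegral_right]), which is a
    polynomial expression because [Q'] has the primitive [Q].  The sum of the
    four bounds, divided by [b - a], is exactly the right-hand side. *)

(** * Differentiability relative to an interval *)

(** The increment of [f] is its difference quotient, which converges, times
    [y - x], which tends to [0]; at endpoints of [I] this gives the one-sided
    continuity of [f]. *)
Lemma cvg_within_derivable_on (R : realType) (I : set R) (f : R -> R) (x : R) :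
  derivable_on I f x -> f @ within I (nbhs x) --> f x.
Proof.
move=> /cvg_ex[/= l ql].
have f0 : (fun y => (f y - f x) / (y - x) * (y - x) + f x) @ within I x^' --> f x.
  rewrite -[X in _ --> X]add0r -(mulr0 l); apply: cvgD; last exact: cvg_cst.
  apply: cvgM => //; rewrite -(subrr x); apply: cvgB; last exact: cvg_cst.
  by apply: cvg_within_filter; apply: cvg_within_filter; exact: cvg_id.
move=> U Ux; have := f0 U Ux.
rewrite /= /nbhs /= /within /= /dnbhs /within /= => fU.
near=> y => Iy; have [->|yx] := eqVneq y x; first exact: nbhs_singleton.
have : U ((f y - f x) / (y - x) * (y - x) + f x) by move: yx Iy; near: y.
by rewrite divfK ?subr_eq0// subrK.
Unshelve. all: by end_near. Qed.

(** Near an interior point the constraint [y \in I] is void, so both limits are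
    taken along the same filter. *)
Lemma derive_on_interior (R : realType) (I : set R) (f : R -> R) (x : R) :
  I° x -> derivable f x 1 -> derive_on I f x = f^`()%classic x.
Proof.
move=> Ix df.
have wI : within I x^' = x^'.
  apply/seteqP; split=> U; rewrite /dnbhs /within /= => IU; last first.
    by apply: filterS IU => y yU yx _; exact: yU.
  have {}IU : nbhs x (fun y => y != x -> I y -> U y) by exact: IU.
  by apply: filterS2 IU Ix => y yU Iy yx; exact: yU.
(* In the form of Caratheodory the difference quotient extends continuously
   to [x], which avoids translating the limit to [0]. *)
have [g [fg cg gx]] : exists g, [/\ forall z, f z - f x = g z * (z - x),
    {for x, continuous g} & g x = f^`()%classic x].
  by apply/is_derive1_caratheodory; rewrite derive1E; exact: derivableP.
rewrite /derive_on wI -gx; apply/cvg_lim => //.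
apply: (@cvg_trans _ (g @ x^')); last by apply/continuous_withinNx.
apply: near_eq_cvg; near=> y.
rewrite fg mulfK// subr_eq0; near: y; exact: nbhs_dnbhs_neq.
Unshelve. all: by end_near. Qed.

(** * Increments of a function whose derivative is dominated *)

Lemma convex_function_le_chord (R : realType) (g : R -> R) (a b x : R) :
  a < b -> convex_function (`[a, b] : set R) g -> a <= x <= b ->
  g x <= (g a * (b - x) + g b * (x - a)) / (b - a).
Proof.
move=> ab cvx /andP[ax xb].
have ba0 : 0 < b - a by rewrite subr_gt0.
have t0 : 0 <= (b - x) / (b - a) by rewrite divr_ge0 ?subr_ge0 // ltW.
have t1 : (b - x) / (b - a) <= 1 by rewrite ler_pdivrMr// mul1r lerB.
have aI : a \in `[a, b]%classic by rewrite inE/= in_itv/= lexx ltW.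
have bI : b \in `[a, b]%classic by rewrite inE/= in_itv/= lexx ltW.
have : g ((b - x) / (b - a) * a + (1 - (b - x) / (b - a)) * b) <=
    (b - x) / (b - a) * g a + (1 - (b - x) / (b - a)) * g b.
  exact: (cvx (Itv01 t0 t1) a b aI bI).
rewrite (_ : _ * a + _ = x); last by field; exact: lt0r_neq0.
move/le_trans; apply; rewrite le_eqVlt; apply/orP; left; apply/eqP.
by field; exact: lt0r_neq0.
Qed.

(** Both [P + f] and [P - f] have a nonnegative derivative, hence are
    nondecreasing on [[a, b]]. *)
Lemma ler_dist_derive1_horner (R : realType) (f : R -> R) (P : {poly R})
    (a b : R) :
  {within `[a, b], continuous f} ->
  (forall x, x \in `]a, b[ -> derivable f x 1) ->
  (forall x, x \in `]a, b[ -> `|f^`()%classic x| <= P^`().[x]) ->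
  forall x y, a <= x -> x <= y -> y <= b -> `|f y - f x| <= P.[y] - P.[x].
Proof.
move=> cf df fP x y ax xy yb.
have cP : {within `[a, b], continuous (horner P)}.
  by apply: continuous_subspaceT; exact: continuous_horner.
have dP z : derivable (horner P) z 1 by exact: derivable_horner.
have addP : P.[x] + f x <= P.[y] + f y.
  apply: (@ger0_derive1_ndecr _ (horner P + f) a b) => //.
  - by move=> z zab; apply: derivableD => //; exact: df.
  - move=> z zab; rewrite derive1E deriveD//; last exact: df.
    rewrite -!derive1E -derivE; move: (fP z zab); rewrite ler_norml; lra.
  - by apply: within_continuousD.
have subP : P.[x] - f x <= P.[y] - f y.
  apply: (@ger0_derive1_ndecr _ (horner P - f) a b) => //.
  - by move=> z zab; apply: derivableB => //; exact: df.
  - move=> z zab; rewrite derive1E deriveB//; last exact: df.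
    rewrite -!derive1E -derivE; move: (fP z zab); rewrite ler_norml; lra.
  - by apply: within_continuousB.
by rewrite ler_norml; apply/andP; split; lra.
Qed.

(** * Integrals over segments *)

Lemma within_continuous_integrable_itv (R : realType) (g : R -> R) (u v : R) :
  {within `[u, v], continuous g} ->
  (@lebesgue_measure R).-integrable `[u, v] (EFin \o g).
Proof.
by move=> cg; apply: continuous_compact_integrable => //; exact: segment_compact.
Qed.

Lemma Rintegral_itv_split (R : realType) (f : R -> R) (u v w : R) :
  u <= v -> v <= w -> {within `[u, w], continuous f} ->
  \int[@lebesgue_measure R]_(x in `[u, w]) f x =
  \int[@lebesgue_measure R]_(x in `[u, v]) f x +
  \int[@lebesgue_measure R]_(x in `[v, w]) f x.
Proof.
move=> uv vw /within_continuous_integrable_itv itf.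
apply/eqP; rewrite addrC -subr_eq; apply/eqP.
rewrite (Rintegral_itvB itf) ?bnd_simp// Rintegral_itv_obnd_cbnd//.
by apply: integrableS itf => //; apply: subset_itvr; rewrite bnd_simp.
Qed.

Lemma Rintegral_deriv_horner (R : realType) (Q : {poly R}) (u v : R) :
  u <= v ->
  \int[@lebesgue_measure R]_(x in `[u, v]) Q^`().[x] = Q.[v] - Q.[u].
Proof.
rewrite le_eqVlt => /predU1P[->|uv].
  by rewrite set_itv1 Rintegral_set1 subrr.
rewrite /Rintegral (@continuous_FTC2 _ _ (horner Q))//.
- by apply: continuous_subspaceT; exact: continuous_horner.
- split.
  + by move=> x _; exact: derivable_horner.
  + by apply: cvg_at_right_filter; exact: continuous_horner.
  + by apply: cvg_at_left_filter; exact: continuous_horner.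
- by move=> x _; rewrite -derivE.
Qed.

Lemma ler_dist_Rintegral_cst (R : realType) (f : R -> R) (c u v : R)
    (G : {poly R}) :
  u <= v -> {within `[u, v], continuous f} ->
  (forall x, u <= x <= v -> `|f x - c| <= G^`().[x]) ->
  `|\int[@lebesgue_measure R]_(x in `[u, v]) f x - (v - u) * c|
    <= G.[v] - G.[u].
Proof.
move=> uv cf fG.
have itg g := @within_continuous_integrable_itv R g u v.
have cc : {within `[u, v], continuous (cst c : R -> R)}.
  by apply: continuous_subspaceT => x; exact: cst_continuous.
have cfc : {within `[u, v], continuous (f \- cst c)}.
  exact: within_continuousB.
have -> : (v - u) * c = \int[@lebesgue_measure R]_(x in `[u, v]) c.
  rewrite Rintegral_cst//= lebesgue_measure_itv/= lte_fin.
  have [_|vu] := ltP u v; first by rewrite -EFinB/= mulrC.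
  by rewrite (@le_anti _ _ u v) ?uv// subrr mul0r mulr0.
rewrite -RintegralB//; [|exact: itg|exact: itg].
apply: (le_trans (le_normr_Rintegral _ _)) => //; first exact: itg.
rewrite -Rintegral_deriv_horner//; apply: le_Rintegral => //.
- exact: integrable_abse (itg _ cfc).
- have cG : {within `[u, v], continuous (horner G^`())}.
    by apply: continuous_subspaceT; exact: continuous_horner.
  exact: itg cG.
Qed.

(** The primitive of [Q' - Q' u] is [Q - Q' u * 'X], whose increment is the
    error made by freezing [Q'] at [u]. *)
Lemma ler_dist_Rintegral_left (R : realType) (f : R -> R) (Q : {poly R})
    (u v : R) :
  u <= v -> {within `[u, v], continuous f} ->
  (forall x, u <= x <= v -> `|f x - f u| <= Q^`().[x] - Q^`().[u]) ->
  `|\int[@lebesgue_measure R]_(x in `[u, v]) f x - (v - u) * f u|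
    <= Q.[v] - Q.[u] - (v - u) * Q^`().[u].
Proof.
move=> uv cf fQ; pose G := Q - Q^`().[u] *: 'X.
have -> : Q.[v] - Q.[u] - (v - u) * Q^`().[u] = G.[v] - G.[u].
  by rewrite /G !(hornerD, hornerN, hornerZ, hornerX); ring.
apply: ler_dist_Rintegral_cst => // x xuv.
by rewrite derivB derivZ derivX hornerD hornerN hornerZ hornerC mulr1 fQ.
Qed.

(** Mirror image of [ler_dist_Rintegral_left]. *)
Lemma ler_dist_Rintegral_right (R : realType) (f : R -> R) (Q : {poly R})
    (u v : R) :
  u <= v -> {within `[u, v], continuous f} ->
  (forall x, u <= x <= v -> `|f v - f x| <= Q^`().[v] - Q^`().[x]) ->
  `|\int[@lebesgue_measure R]_(x in `[u, v]) f x - (v - u) * f v|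
    <= (v - u) * Q^`().[v] - (Q.[v] - Q.[u]).
Proof.
move=> uv cf fQ; pose G := Q^`().[v] *: 'X - Q.
have -> : (v - u) * Q^`().[v] - (Q.[v] - Q.[u]) = G.[v] - G.[u].
  by rewrite /G !(hornerD, hornerN, hornerZ, hornerX); ring.
apply: ler_dist_Rintegral_cst => // x xuv; rewrite distrC.
by rewrite derivB derivZ derivX hornerD hornerN hornerZ hornerC mulr1 fQ.
Qed.

(** * The quadrature inequality *)

Theorem theorem3p1 (R : realType) (I : set R) (f : R -> R)
    (a b lam mu : R)
    (hI : is_interval I)
    (hf : forall x : R, I° x -> derivable f x 1)
    (ha : I a) (hb : I b) (hab : a < b)
    (hlam0 : 0 <= lam) (hlam : lam <= 1 / 2)
    (hmu : 1 / 2 <= mu) (hmu1 : mu <= 1)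
    (hf'ex : forall x : R, x \in `[a, b] -> derivable_on I f x)
    (hf'int : (@lebesgue_measure R).-integrable `[a, b]
                (EFin \o derive_on I f))
    (hconv : convex_function (`[a, b] : set R)
               (fun x : R => `|derive_on I f x|)) :
  `| (1 - mu) * f a + lam * f b + (mu - lam) * f ((a + b) / 2)
     - (b - a)^-1 * \int[@lebesgue_measure R]_(x in `[a, b]) f x |
  <= (b - a) / 24 *
     ((10 - 3 * lam + 8 * lam ^+ 3 - 15 * mu + 8 * mu ^+ 3)
        * `|derive_on I f a|
      + (8 - 9 * lam + 24 * lam ^+ 2 - 8 * lam ^+ 3
         - 21 * mu + 24 * mu ^+ 2 - 8 * mu ^+ 3)
        * `|derive_on I f b|).
Proof.
have hornE := (hornerD, hornerN, hornerZ, horner_exp, hornerC, hornerX,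
  hornerM, hornerMn).
have h0 : 0 < b - a by rewrite subr_gt0.
have hn0 : b - a != 0 by exact: lt0r_neq0.
have abI : `[a, b]%classic `<=` I.
  by move=> x /=; rewrite in_itv/= => /andP[ax xb]; apply: (hI a b) => //; rewrite ax xb.
have intI x : x \in `]a, b[ -> I° x.
  move=> xab; have : \forall z \near x, z \in `]a, b[ by exact: near_in_itvoo.
  apply: filterS => z zab; apply: abI => /=; exact: subset_itv_oo_cc.
have cf : {within `[a, b], continuous f}.
  apply/subspace_continuousP => x xab.
  have := cvg_within_derivable_on (hf'ex x xab); apply: cvg_trans.
  by apply: cvg_app; exact: within_subset.
set A := `|derive_on I f a| in hconv *; set B := `|derive_on I f b| in hconv *.
(* The cubic whose second derivative is the chord of [`|f'|] on [[a, b]]. *)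
pose Q : {poly R} := (A / (6 * (b - a))) *: (b%:P - 'X) ^+ 3
                   + (B / (6 * (b - a))) *: ('X - a%:P) ^+ 3.
pose P := Q^`().
have QE x : Q.[x] = (A * (b - x) ^+ 3 + B * (x - a) ^+ 3) / (6 * (b - a)).
  by rewrite /Q !hornE; field.
have PE x : P.[x] = (B * (x - a) ^+ 2 - A * (b - x) ^+ 2) / (2 * (b - a)).
  by rewrite /P /Q !derivCE !hornE; field.
have LE x : P^`().[x] = (A * (b - x) + B * (x - a)) / (b - a).
  by rewrite /P /Q !derivCE !hornE; field.
have fP x y : a <= x -> x <= y -> y <= b -> `|f y - f x| <= P.[y] - P.[x].
  apply: ler_dist_derive1_horner => // z zab; first exact/hf/intI.
  rewrite -(derive_on_interior (intI z zab) (hf _ (intI z zab))) LE.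
  apply: (convex_function_le_chord hab hconv).
  by move: zab; rewrite in_itv/= => /andP[/ltW -> /ltW ->].
pose m := (a + b) / 2; pose p := b - mu * (b - a); pose q := b - lam * (b - a).
have ap : a <= p by rewrite /p; nra.
have pm : p <= m by rewrite /p /m; nra.
have mq : m <= q by rewrite /q /m; nra.
have qb : q <= b by rewrite /q; nra.
have cfS u v : a <= u -> v <= b -> {within `[u, v], continuous f}.
  by move=> au vb; apply: continuous_subspaceW cf; exact: subset_itvScc.
have am : a <= m by exact: le_trans pm.
have mb : m <= b by exact: le_trans qb.
have pb : p <= b by exact: le_trans mb.
have aq : a <= q by exact: le_trans mq.
pose J u v := \int[@lebesgue_measure R]_(x in `[u, v]) f x.
rewrite -/(J a b) -/m.
have -> : J a b = J a p + (J p m + (J m q + J q b)).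
  by rewrite /J (Rintegral_itv_split ap pb) ?(Rintegral_itv_split pm mb)
    ?(Rintegral_itv_split mq qb) //; exact: cfS.
have e1 : `|J a p - (p - a) * f a| <= Q.[p] - Q.[a] - (p - a) * P.[a].
  apply: (ler_dist_Rintegral_left ap (cfS a p _ _)) => // x /andP[ax xp].
  by apply: fP => //; exact: le_trans pb.
have e2 : `|J p m - (m - p) * f m| <= (m - p) * P.[m] - (Q.[m] - Q.[p]).
  apply: (ler_dist_Rintegral_right pm (cfS p m _ _)) => // x /andP[px xm].
  by apply: fP => //; exact: le_trans px.
have e3 : `|J m q - (q - m) * f m| <= Q.[q] - Q.[m] - (q - m) * P.[m].
  apply: (ler_dist_Rintegral_left mq (cfS m q _ _)) => // x /andP[mx xq].
  by apply: fP => //; exact: le_trans qb.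
have e4 : `|J q b - (b - q) * f b| <= (b - q) * P.[b] - (Q.[b] - Q.[q]).
  apply: (ler_dist_Rintegral_right qb (cfS q b _ _)) => // x /andP[qx xb].
  by apply: fP => //; exact: le_trans qx.
(* The weights of the nodes are the relative lengths of the intervals. *)
have -> : (1 - mu) * f a + lam * f b + (mu - lam) * f m
   - (b - a)^-1 * (J a p + (J p m + (J m q + J q b))) =
   - (b - a)^-1 * ((J a p - (p - a) * f a) + (J p m - (m - p) * f m)
     + (J m q - (q - m) * f m) + (J q b - (b - q) * f b)).
  by rewrite /p /q; field.
rewrite normrM normrN normfV (gtr0_norm h0) ler_pdivrMl//.
apply: (@le_trans _ _ (_ + _ + _ + _)).
  apply: (le_trans (ler_normD _ _)); apply: lerD e4.
  apply: (le_trans (ler_normD _ _)); apply: lerD e3.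
  by apply: (le_trans (ler_normD _ _)); exact: lerD e1 e2.
rewrite !QE !PE /m /p /q le_eqVlt; apply/orP; left; apply/eqP.
by field.
Qed.
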